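(* Let $\mathcal G$ be a finite abelian group of exponent $m$ and let $C$ be a cycle. Then $C$ is zero-forcing for $\mathcal G$ if and only if $|V(C)|\geq 1+\frac{m-1}{m}|\mathcal G|$.
   Context: The exponent of $\mathcal G$ is the minimum positive integer $m$ with $mx=0$ for all $x\in\mathcal G$. A $\mathcal G$-labeling of a graph $G$ is a map $\ell: V(G)\to\mathcal G$, extended by $\ell(A)=\sum_{x\in A}\ell(x)$. A set $A\subseteq V(G)$ is connected if $G[A]$ is connected. $(G,\ell)$ is zero-avoiding if $\ell(A)\neq0$ for every non-empty connected $A\subseteq V(G)$. $G$ is zero-forcing for $\mathcal G$ if no $\mathcal G$-labeling $\ell$ makes $(G,\ell)$ zero-avoiding. *)

(* Defs.v *)
From HB Require Import structures.
From mathcomp Require Import all_boot all_order all_algebra.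

Set Implicit Arguments.
Unset Strict Implicit.
Unset Printing Implicit Defensive.

Import GRing.Theory.
Local Open Scope ring_scope.

Definition is_exponent (G : finZmodType) (m : nat) : Prop :=
  [/\ (0 < m)%N,
      forall x : G, x *+ m = 0
    & forall k : nat, (0 < k)%N -> (forall x : G, x *+ k = 0) -> (m <= k)%N].

Record sgraph := SGraph {
  vertex :> finType;
  adj : rel vertex;
  adj_sym : symmetric adj;
  adj_irrefl : irreflexive adj }.

Definition induced_adj (H : sgraph) (A : {set H}) : rel H :=
  [rel x y | [&& x \in A, y \in A & adj x y]].

(* The empty set satisfies this vacuously; it is excluded separately in
   [zero_avoiding]. *)
Definition connected_set (H : sgraph) (A : {set H}) : Prop :=
  {in A &, forall x y, connect (induced_adj A) x y}.

(* [next s] is the cyclic successor along [s], wrapping from the last item to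
   the first. *)
Definition is_cycle (H : sgraph) : Prop :=
  exists s : seq H,
    [/\ uniq s, (3 <= size s)%N, forall x : H, x \in s
      & forall x y : H, adj x y = (next s x == y) || (next s y == x)].

Definition label_sum (G : finZmodType) (H : sgraph) (l : H -> G)
    (A : {set H}) : G :=
  \sum_(x in A) l x.

Definition zero_avoiding (G : finZmodType) (H : sgraph) (l : H -> G) : Prop :=
  forall A : {set H}, A != set0 -> connected_set A -> label_sum l A <> 0.

Definition zero_forcing (G : finZmodType) (H : sgraph) : Prop :=
  ~ exists l : H -> G, zero_avoiding l.

(* Main.v *)
Require Import Defs.
From mathcomp Require Import all_boot all_order all_algebra all_fingroup.
From mathcomp Require Import all_solvable zify ring.

(** The non-empty connected sets of a cycle are its arcs, and arc sums are
    differences of partial sums [sigma i] of the labels, continued around the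
    cycle by [sigma (i + n) = sigma i + t] with [t] the total.  So a
    zero-avoiding labeling amounts to [t <> 0] and distinct [sigma 0], ...,
    [sigma (n - 1)] such that adding [t] never leads to a later term.  No coset
    of [<[t]>] is then entirely covered by the [sigma i]: the earliest term in
    the coset plus [t] would be a later one.  Hence [n <= |G| - |G|/#[t]],
    which is at most [|G| - |G|/m].  Equality is attained by taking [t] of
    order [m], leaving out one element per coset, and listing the others
    against the direction of [t]. *)

Set Implicit Arguments.
Unset Strict Implicit.
Unset Printing Implicit Defensive.

Import Order.TTheory GRing.Theory Num.Theory.
Local Open Scope ring_scope.

(** * Arcs and connected sets of a cycle *)

Lemma induced_adj_connect_sym (H : sgraph) (A : {set H}) :
  connect_sym (induced_adj A).
Proof.
apply: sym_connect_sym => x y; rewrite /induced_adj /= andbCA.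
by rewrite (@adj_sym H x y).
Qed.

Section CycleArcs.

Variables (C : sgraph) (x0 : C) (s : seq C).
Hypothesis s_uniq : uniq s.
Hypothesis s_full : forall x, x \in s.
Hypothesis s_adj : forall x y, adj x y = (next s x == y) || (next s y == x).
Let n := size s.

(** Indices are arbitrary naturals, so that an arc crossing the origin is still an interval of
    indices. *)
Definition cyc_nth (j : nat) : C := nth x0 s (j %% n).
Local Notation v := cyc_nth.

Definition arc (i k : nat) : {set C} := [set x in [seq v j | j <- iota i k]].

Let n_gt0 : (0 < n)%N.
Proof. by move: (s_full x0); rewrite /n; case: s. Qed.

Lemma cyc_nth_index x : v (index x s) = x.
Proof. by rewrite /v modn_small ?nth_index ?index_mem. Qed.

Lemma cyc_nth_addn j : v (j + n) = v j.
Proof. by rewrite /v modnDr. Qed.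

Lemma cyc_nth_eq i j : (v i == v j) = (i == j %[mod n]).
Proof. by rewrite /v nth_uniq ?ltn_pmod. Qed.

Lemma next_cyc_nth j : next s (v j) = v j.+1.
Proof.
rewrite next_nth s_full /v -addn1 -[in RHS]modnDml addn1.
have := ltn_pmod j n_gt0; move: (j %% n)%N => r lt_rn.
rewrite index_uniq //; move: lt_rn; rewrite /n; case: s => [//|y p] /=.
rewrite ltnS leq_eqVlt => /predU1P[->|lt_rp].
  (* At the last index, [next] reads past the tail [p]; the default [y], the head of the cycle, is
     the wrap-around. *)
  by rewrite modnn nth_default.
by rewrite modn_small //=; apply: set_nth_default.
Qed.

Lemma adj_cyc_nth i j :
  adj (v i) (v j) = (i.+1 == j %[mod n]) || (j.+1 == i %[mod n]).
Proof. by rewrite s_adj !next_cyc_nth !cyc_nth_eq. Qed.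

Lemma mem_arc i k x :
  reflect (exists2 j, (j < k)%N & x = v (i + j)) (x \in arc i k).
Proof.
rewrite inE; apply: (iffP mapP) => [[j]|[j lt_jk ->]].
  rewrite mem_iota => /andP[le_ij lt_jik] ->.
  by exists (j - i)%N; [lia | rewrite subnKC].
by exists (i + j)%N => //; rewrite mem_iota leq_addr ltn_add2l.
Qed.

Lemma arc_full i : arc i n = setT.
Proof.
apply/setP => x; rewrite in_setT; apply/mem_arc.
exists ((index x s + (n - i %% n)) %% n)%N; first exact: ltn_pmod.
rewrite -{1}(cyc_nth_index x); apply/eqP; rewrite cyc_nth_eq modnDmr.
have lt_i := ltn_pmod i n_gt0.
rewrite -modnDml addnCA subnKC ?modnDr //; exact: ltnW.
Qed.

Lemma label_sum_arc (G : finZmodType) (l : C -> G) i k : (k <= n)%N ->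
  label_sum l (arc i k) = \sum_(i <= j < i + k) l (v j).
Proof.
move=> le_kn; rewrite /label_sum /arc.
rewrite (eq_bigl (mem [seq v j | j <- iota i k]));
  last by move=> x; rewrite inE.
rewrite -big_uniq; last first.
  rewrite map_inj_in_uniq ?iota_uniq // => a b.
  rewrite !mem_iota => /andP[ia ak] /andP[ib bk] /eqP; rewrite cyc_nth_eq.
  rewrite -(subnKC ia) -(subnKC ib) eqn_modDl !modn_small; lia.
by rewrite big_map /index_iota addKn.
Qed.

Lemma connected_arc i k : connected_set (arc i k).
Proof.
have symA := induced_adj_connect_sym (arc i k).
have base j : (j < k)%N -> connect (induced_adj (arc i k)) (v i) (v (i + j)).
  elim: j => [|j IHj] lt_jk; first by rewrite addn0 connect0.
  apply: connect_trans (IHj (ltnW lt_jk)) (connect1 _).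
  apply/and3P; split; try (apply/mem_arc; eexists; last by []); try lia.
  by rewrite adj_cyc_nth addnS eqxx.
move=> x y /mem_arc[a lt_ak ->] /mem_arc[b lt_bk ->].
by apply: (connect_trans (y := v i)); [rewrite symA|]; apply: base.
Qed.

(** Going around the cycle, a proper non-empty [A] is entered at some [v i.+1]. The maximal run of
    [A] from there is closed under adjacency in [A], so connectedness makes it all of [A]. *)
Lemma connected_set_arc (A : {set C}) : A != set0 -> connected_set A ->
  exists i k, [/\ (i < n)%N, (0 < k <= n)%N & A = arc i k].
Proof.
move=> A_neq0 connA.
have [->|/eqP A_neqT] := eqVneq A setT.
  by exists 0%N, n; rewrite arc_full n_gt0 leqnn.
have [i [ltin vi_notin vi1_in]] :
    exists i, [/\ (i < n)%N, v i \notin A & v i.+1 \in A].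
  have [/existsP[i /andP[H1 H2]]|/existsPn noex] :=
    boolP [exists i : 'I_n, (v i \notin A) && (v i.+1 \in A)].
    by exists i.
  have [y yA] : exists y, y \notin A.
    by apply/existsP; apply: contra_notT A_neqT => /existsPn H;
       apply/setP => y; rewrite in_setT; apply/negPn/H.
  (* If [A] is never entered, starting outside it means staying outside all the way around. *)
  have out j : v (index y s + j) \notin A.
    elim: j => [|j IHj]; first by rewrite addn0 cyc_nth_index.
    set t := (index y s + j)%N in IHj *.
    have /= := noex (Ordinal (ltn_pmod t n_gt0)).
    have /eqP-> : v (t %% n) == v t by rewrite cyc_nth_eq modn_mod.
    have /eqP-> : v (t %% n).+1 == v t.+1.
      by rewrite cyc_nth_eq -addn1 modnDml addn1.
    by rewrite IHj addnS.
  case/set0Pn: A_neq0 => x xA.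
  have : x \in arc (index y s) n by rewrite arc_full.
  by case/mem_arc=> j _ Ex; move: (out j); rewrite -Ex xA.
have exk : exists k, v (i.+1 + k) \notin A.
  by exists n.-1; rewrite addSnnS prednK // cyc_nth_addn.
case: (ex_minnP exk) => k vk_notin k_min.
have k_gt0 : (0 < k)%N.
  by case: k vk_notin {k_min} => //; rewrite addn0 vi1_in.
have ltkn : (k < n)%N.
  have /k_min : v (i.+1 + n.-1) \notin A.
    by rewrite addSnnS prednK // cyc_nth_addn.
  by lia.
have arcA : {subset arc i.+1 k <= A}.
  move=> _ /mem_arc[j lt_jk ->]; apply/negPn/negP => /k_min; lia.
(* A neighbour can leave the run only at its ends, [v i] and [v (i.+1 + k)], and neither lies in
   [A]. *)
have clos : closed (induced_adj A) (arc i.+1 k).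
  apply: intro_closed; first exact: induced_adj_connect_sym.
  move=> x y /and3P[_ yA xy] /mem_arc[j lt_jk Ex]; move: xy; rewrite Ex.
  rewrite s_adj next_cyc_nth => /orP[/eqP Ey|/eqP Ey].
    apply/mem_arc; exists j.+1; last by rewrite -Ey addnS.
    rewrite ltn_neqAle lt_jk andbT; apply: contraTneq yA => Ej.
    by rewrite -Ey -addnS Ej.
  move: Ey; rewrite -(cyc_nth_index y) next_cyc_nth => /eqP.
  rewrite cyc_nth_eq addSn -addn1 -[(i + j).+1]addn1 eqn_modDr -cyc_nth_eq.
  rewrite cyc_nth_index => /eqP Ey.
  case: j lt_jk {Ex} Ey => [|j] lt_jk Ey.
    by move: yA; rewrite Ey addn0 (negbTE vi_notin).
  by apply/mem_arc; exists j; [lia | rewrite Ey addSnnS].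
exists (i.+1 %% n)%N, k; split; rewrite ?ltn_pmod ?k_gt0 ?(ltnW ltkn) //.
have -> : arc (i.+1 %% n) k = arc i.+1 k.
  by apply/setP => x; apply/mem_arc/mem_arc => -[j ltj ->]; exists j => //;
     apply/eqP; rewrite cyc_nth_eq modnDml.
apply/eqP; rewrite eqEsubset; apply/andP; split; apply/subsetP => // x xA.
have vB : v i.+1 \in arc i.+1 k by apply/mem_arc; exists 0%N; rewrite ?addn0.
by rewrite -(closed_connect clos (connA _ _ vi1_in xA)).
Qed.

Lemma zero_avoidingP (G : finZmodType) (l : C -> G) :
  zero_avoiding l <->
  (forall i k, (i < n)%N -> (0 < k <= n)%N ->
     \sum_(i <= j < i + k) l (v j) <> 0).
Proof.
split=> [avoid i k _ /andP[k_gt0 le_kn]|nz A A0 /(connected_set_arc A0)].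
  rewrite -label_sum_arc //; apply: avoid; last exact: connected_arc.
  by apply/set0Pn; exists (v i); apply/mem_arc; exists 0%N; rewrite ?addn0.
case=> i [k [lt_in /[dup] k_bnd /andP[_ le_kn] ->]].
by rewrite label_sum_arc //; apply: nz.
Qed.

End CycleArcs.


(** * Partial-sum sequences in a finite abelian group *)

Section PartialSums.

Variable G : finZmodType.

(* [sigma] plays the role of the partial sums of the labels along the cycle and
   [t] that of their total; the last clause says that no arc crossing the origin
   has sum zero. *)
Definition admissible (n : nat) (t : G) (sigma : nat -> G) : Prop :=
  [/\ t != 0,
      {in gtn n &, injective sigma}
    & forall i j, (i < j < n)%N -> sigma j != sigma i + t].

Lemma admissible_card m n t sigma : (0 < m)%N -> (forall x : G, x *+ m = 0) ->
  admissible n t sigma -> (m * n + #|G| <= m * #|G|)%N.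
Proof.
move=> m_gt0 Gm [t_neq0 sigma_inj sigma_t].
pose S := [set sigma i | i : 'I_n].
have cardS : #|S| = n.
  by rewrite card_imset ?card_ord // => i j /sigma_inj-/(_ _ _)/val_inj->;
     rewrite // inE.
pose H := <[t]>%G.
have missed x : exists2 y, y \notin S & y \in (H :* x)%g.
  apply/exists_inP; rewrite -[X in is_true X]negbK.
  apply/negP => /exists_inPn all_in.
  have inS y : y \in (H :* x)%g -> exists2 i : 'I_n, y = sigma i & true.
    move=> yHx; have /negPn : ~~ (y \notin S).
      by apply: contraL yHx => /all_in.
    by case/imsetP=> i _ ->; exists i.
  have [i0 Ei0 _] := inS x (rcoset_refl _ _).
  pose P (i : 'I_n) := sigma i \in (H :* x)%g.
  have Pi0 : P i0 by rewrite /P -Ei0 rcoset_refl.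
  case: (arg_minnP (fun i : 'I_n => i : nat) Pi0) => i Pi i_min.
  have Pit : sigma i + t \in (H :* x)%g.
    move: Pi; rewrite /P !mem_rcoset !FinRing.zmodMgE addrAC => Pi.
    by rewrite -FinRing.zmodMgE groupM // cycle_id.
  have [j Ej _] := inS _ Pit.
  have := i_min j; rewrite /P -Ej => /(_ Pit).
  rewrite leq_eqVlt => /predU1P[/val_inj Eij|lt_ij].
    move: Ej; rewrite -Eij -[RHS]addr0 => /addrI /eqP.
    by rewrite (negbTE t_neq0).
  by have := sigma_t i j; rewrite lt_ij ltn_ord Ej eqxx => /(_ isT).
(* Sending each missed element to its coset is onto the cosets of [H]. *)
have le_idx : (#|[set: G] : H|%g <= #|~: S|)%N.
  rewrite /indexg; apply: leq_trans (leq_imset_card (rcoset H) _).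
  apply/subset_leq_card/subsetP => _ /rcosetsP[x _ ->].
  have [y yS yHx] := missed x.
  by apply/imsetP; exists y; rewrite ?in_setC // rcosetE; apply/esym/rcoset_eqP.
have le_ord : (#|H| <= m)%N.
  rewrite -orderE dvdn_leq // order_dvdn FinRing.zmodXgE Gm.
  by rewrite FinRing.zmod1gE.
have := cardsC S; rewrite cardS => cardG.
rewrite -[X in (_ <= m * X)%N]cardG mulnDr leq_add2l -cardsT.
by rewrite -(Lagrange (subsetT H)) leq_mul.
Qed.

(** A nilpotent group, in particular an abelian one, has an element whose order is the group
    exponent. *)
Lemma order_exponent m : is_exponent G m -> exists e : G, #[e]%g = m.
Proof.
case=> m_gt0 Gm m_min.
have abG : abelian [set: G].
  by apply/centsP => x _ y _; rewrite /commute !FinRing.zmodMgE addrC.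
have [e _ Ee] := exponent_witness (abelian_nil abG); exists e.
apply/eqP; rewrite -Ee eqn_leq; apply/andP; split.
  apply: dvdn_leq => //; apply/exponentP => x _.
  by rewrite FinRing.zmodXgE Gm FinRing.zmod1gE.
apply: m_min => [|x]; first exact: exponent_gt0.
by rewrite -FinRing.zmodXgE (expg_exponent (in_setT x)) FinRing.zmod1gE.
Qed.

(* The sequence lists a transversal of the cosets of <[e]>, then its
   translates by e, ..., (m - 2) e; since the last translate is left
   out, adding -e never leads to a later term. *)
Lemma admissible_exists m n : is_exponent G m -> (0 < n)%N ->
  (m * n + #|G| <= m * #|G|)%N -> exists t sigma, admissible n t sigma.
Proof.
move=> Gm n_gt0 bound; have [m_gt0 _ _] := Gm.
have [e Ee] := order_exponent Gm.
pose H := <[e]>%G; pose c := #|[set: G] : H|%g.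
have cardG : (m * c)%N = #|G|.
  by rewrite -[RHS]cardsT -(Lagrange (subsetT H)) -orderE Ee.
have c_gt0 : (0 < c)%N by exact: indexg_gt0.
have le_n : (n + c <= m * c)%N by rewrite -(leq_pmul2l m_gt0) cardG; nia.
pose cs := enum (rcosets H [set: G]).
have size_cs : size cs = c by rewrite -cardE.
pose T i := repr (nth set0 cs i).
have T_coset i : (i < c)%N -> (H :* T i)%g = nth set0 cs i.
  rewrite -size_cs => /(mem_nth set0); rewrite mem_enum => /rcosetsP[x _ Ex].
  by rewrite /T Ex; apply/rcoset_eqP/mem_repr_rcoset.
have T_inj i j a b : (i < c)%N -> (j < c)%N ->
    T i + e *+ a = T j + e *+ b -> i = j.
  move=> lt_ic lt_jc Eij; apply/eqP.
  rewrite -(@nth_uniq _ set0 cs) ?size_cs ?enum_uniq //.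
  rewrite -!T_coset //; apply/eqP/rcoset_eqP.
  have -> : T i = T j + (e *+ b - e *+ a) by rewrite addrA -Eij addrK.
  rewrite mem_rcoset !FinRing.zmodMgE FinRing.zmodVgE addrAC subrr add0r.
  rewrite -!FinRing.zmodXgE -FinRing.zmodVgE -FinRing.zmodMgE.
  by rewrite groupM ?groupV // mem_cycle.
have e_inj a b : (a < m)%N -> (b < m)%N -> e *+ a = e *+ b -> a = b.
  move=> am bm /eqP; rewrite -!FinRing.zmodXgE eq_expg_mod_order Ee.
  by rewrite !modn_small // => /eqP.
(* Since [n <= (m - 1) * c], only the translates by multiples of [e] up to [m - 2] occur. *)
have quo i : (i < n)%N -> ((i %/ c).+1 < m)%N.
  move=> lt_in; have : (i %/ c < m.-1)%N by rewrite ltn_divLR //; nia.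
  by lia.
exists (- e), (fun i => T (i %% c)%N + e *+ (i %/ c)); split.
- rewrite oppr_eq0; apply/eqP => e0.
  have := quo 0%N n_gt0; rewrite div0n => m_gt1.
  by have := e_inj 0%N 1%N m_gt0 m_gt1; rewrite e0 !mul0rn => /(_ erefl).
- move=> i j; rewrite !inE => /quo lt_i /quo lt_j Eij.
  have Er := T_inj _ _ _ _ (ltn_pmod i c_gt0) (ltn_pmod j c_gt0) Eij.
  move: Eij; rewrite Er => /addrI /e_inj Eq.
  by rewrite (divn_eq i c) (divn_eq j c) Er Eq //; lia.
- move=> i j /andP[lt_ij lt_jn]; apply/eqP => Eij.
  have lt_i := quo i (ltn_trans lt_ij lt_jn); have lt_j := quo j lt_jn.
  (* Both multiples of [e] stay below [m], so equality would put [i] in a later block than [j],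
     against [i < j]. *)
  have {}Eij : T (j %% c)%N + e *+ (j %/ c).+1 = T (i %% c)%N + e *+ (i %/ c).
    by rewrite mulrSr addrA Eij -addrA addNr addr0.
  have Er := T_inj _ _ _ _ (ltn_pmod j c_gt0) (ltn_pmod i c_gt0) Eij.
  move: Eij; rewrite Er => /addrI /e_inj Eq.
  have := leq_div2r c (ltnW lt_ij); rewrite -Eq //; lia.
Qed.

End PartialSums.

(** * From labelings to partial sums and back, and the theorem *)

Lemma zero_avoiding_admissible (G : finZmodType) (C : sgraph) : is_cycle C ->
  (exists l : C -> G, zero_avoiding l) <->
  (exists t (sigma : nat -> G), admissible #|C| t sigma).
Proof.
case=> s [s_uniq s_size s_full s_adj].
have cardC : #|C| = size s.
  by rewrite -(card_uniqP s_uniq); apply: eq_card => x; rewrite s_full.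
have [x0 _] : exists x, x \in s.
  case: s s_size {s_uniq s_full s_adj cardC} => // x s' _.
  by exists x; rewrite mem_head.
have za := @zero_avoidingP C x0 s s_uniq s_full s_adj G.
rewrite cardC; set n := size s in za *.
have n_gt0 : (0 < n)%N by exact: leq_trans s_size.
have v_n j : cyc_nth x0 s (n + j) = cyc_nth x0 s j by rewrite /cyc_nth modnDl.
split=> [[l /za{}za]|[t [sigma [t_neq0 sigma_inj sigma_t]]]].
  pose sigma i := \sum_(0 <= j < i) l (cyc_nth x0 s j).
  have sumE i k :
      \sum_(i <= j < i + k) l (cyc_nth x0 s j) = sigma (i + k)%N - sigma i.
    rewrite /sigma (@big_cat_nat _ _ _ i 0 (i + k)) ?leq_addr //=.
    by rewrite addrAC subrr add0r.
  have sigma_n i : sigma (n + i)%N = sigma i + sigma n.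
    rewrite addrC /sigma (@big_cat_nat _ _ _ n 0 (n + i)) ?leq_addr //=.
    congr (_ + _); rewrite -{1}[n]add0n big_addn addKn.
    by apply: eq_bigr => j _; rewrite addnC v_n.
  exists (sigma n), sigma; split.
  - apply/eqP => E; apply: (za 0%N n n_gt0); first by rewrite n_gt0 leqnn.
    by rewrite sumE add0n E /sigma big_geq // subr0.
  - have neq i j : (i < j < n)%N -> sigma i <> sigma j.
      move=> /andP[ij jn] E; apply: (za i (j - i)%N); try lia.
      by rewrite sumE subnKC ?E ?subrr // ltnW.
    move=> i j; rewrite !inE => lt_in lt_jn E.
    by case: (ltngtP i j) => // lt; [case: (neq i j)|case: (neq j i)];
       rewrite ?lt ?E.
  - move=> i j /andP[ij jn]; apply/eqP => E.
    (* The arc from [j] through the origin up to just before [i] has sum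
       [sigma i + sigma n - sigma j]. *)
    apply: (za j (n + i - j)%N); try lia.
    rewrite sumE subnKC; last by lia.
    by rewrite sigma_n E subrr.
(* [tau] continues [sigma] around the cycle, gaining [t] per turn; the labels are its increments. *)
pose tau i := sigma (i %% n)%N + t *+ (i %/ n).
have tau_n i : tau (i + n)%N = tau i + t.
  by rewrite /tau modnDr divnDr // divnn n_gt0 addn1 mulrSr addrA.
pose l x := tau (index x s).+1 - tau (index x s).
have lE j : l (cyc_nth x0 s j) = tau j.+1 - tau j.
  rewrite /l /cyc_nth index_uniq ?ltn_pmod //.
  have shift i q : tau (q * n + i)%N = tau i + t *+ q.
    elim: q => [|q IHq]; first by rewrite addr0.
    by rewrite mulSn -addnA addnC tau_n IHq mulrSr addrA.
  rewrite [in RHS](divn_eq j n) -addnS !shift.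
  by rewrite [in RHS]opprD [in RHS]addrACA subrr addr0.
have small i : (i < n)%N -> tau i = sigma i.
  by move=> lt_in; rewrite /tau modn_small // divn_small // addr0.
exists l; apply/za => i k lt_in /andP[k_gt0 le_kn].
rewrite (eq_bigr _ (fun j _ => lE j)) telescope_sumr ?leq_addr //.
move/eqP; rewrite subr_eq0; have [lt_ikn|le_nik] := ltnP (i + k) n.
  rewrite !small // => /eqP /sigma_inj; rewrite !inE; lia.
rewrite -(subnK le_nik) tau_n !small //; last by lia.
(* For an arc reaching the origin, [i + k - n <= i]: equality is the whole cycle, with sum [t], and
   otherwise the last clause of [admissible] applies. *)
have := sigma_t (i + k - n)%N i; have [-> _|neq] := eqVneq (i + k - n)%N i.
  by rewrite -subr_eq0 addrAC subrr add0r (negbTE t_neq0).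
rewrite eq_sym lt_in andbT ltn_neqAle neq /= => H.
by apply/negP/H; lia.
Qed.

Theorem theorem6p2 (G : finZmodType) (m : nat) (C : sgraph)
    (hm : is_exponent G m) (hC : is_cycle C) :
  zero_forcing G C <->
  (1 + (m%:R - 1) / m%:R * #|G|%:R <= #|C|%:R :> rat).
Proof.
have [m_gt0 Gm _] := hm.
have C_gt0 : (0 < #|C|)%N.
  case: hC => s [s_uniq s_size _ _].
  apply: leq_trans (max_card (mem s)); rewrite (card_uniqP s_uniq).
  exact: leq_trans s_size.
have m_pos : 0 < m%:R :> rat by rewrite ltr0n.
(* Multiplying by [m] clears the denominator; moving [#|G|] across avoids subtraction in [nat]. *)
have -> : (1 + (m%:R - 1) / m%:R * #|G|%:R <= #|C|%:R :> rat) =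
    (m * #|G| + m <= m * #|C| + #|G|)%N.
  rewrite -(ler_nat rat) !natrD !natrM -(ler_pM2l m_pos).
  have -> : m%:R * (1 + (m%:R - 1) / m%:R * #|G|%:R) =
      m%:R * #|G|%:R + m%:R - #|G|%:R :> rat by field; rewrite gt_eqF.
  by rewrite lerBlDr.
have bound : (exists l : C -> G, zero_avoiding l) <->
    (m * #|C| + #|G| <= m * #|G|)%N.
  split=> [/(zero_avoiding_admissible _ hC)[t [sigma]]|bound].
    exact: admissible_card.
  apply/(zero_avoiding_admissible _ hC); exact: admissible_exists bound.
(* Both sides of [bound] are then multiples of [m], so when it fails they differ by at least [m],
   which gives the extra term [m]. *)
have dvdG : (m %| #|G|)%N.
  have [e <-] := order_exponent hm.
  by rewrite -cardsT; apply/order_dvdG/in_setT.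
rewrite /zero_forcing bound; case/dvdnP: dvdG => q ->.
rewrite [(q * m)%N]mulnC -mulnDr -mulnSr !leq_pmul2l //.
by rewrite ltnNge; split=> /negP.
Qed.
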